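(* Let $k>2$, $sc_k=(k,k-1,\ldots,1)$, $S\in SYT(sc_k)$ and $n=k(k+1)/2$. Then evacuation $\epsilon$ rotates $\mathrm{Des}_e(S)$ to the right by one position and then flips the result of the rotation. More precisely, the $i$-th box of $\mathrm{Des}_e(\epsilon(S))$ is dotted if and only if the $(2n-i)$-th (mod $2n$) box of $\mathrm{Des}_e(S)$ is dotted.
   Context: Tableaux are in English notation; box $(i,j)$ is in row $i$ from the top and column $j$ from the left, and $T[i,j]$ is the entry of $T$ in that box. $SYT(\lambda)$ is the set of standard Young tableaux of shape $\lambda$. Promotion: for $T\in SYT(\lambda)$ with $|\lambda|=m$, remove the entry $m$ from its box, leaving it empty. Repeatedly move into the empty box the larger of the entries directly north and directly west of it (or the only one present), so the empty box moves to the position of that entry, until the empty box reaches $(1,1)$. This process is called sliding. Then put $0$ in the empty box and add $1$ to every entry. The result is $\partial(T)\in SYT(\lambda)$. Evacuation: for $T\in SYT(\lambda)$ with $|\lambda|=m$, put $T_0=T$, $\lambda_0=\lambda$. For $k=0,1,\ldots,m-1$: in $T_k$ (a filling of the skew shape $\lambda_k$) remove the largest entry, leaving its box empty, and repeatedly move into the empty box the larger of the entries in the boxes of $\lambda_k$ directly north and directly west of it (or the only one present), so the empty box moves to the position of that entry, until no box of $\lambda_k$ lies directly north or west of it; let $(i_k,j_k)$ be its final position. Set $\epsilon(T)[i_k,j_k]=k+1$. Delete box $(i_k,j_k)$ to obtain $\lambda_{k+1}$ and $T_{k+1}$. This defines $\epsilon(T)\in SYT(\lambda)$. Descents: $i$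 is a descent of $T$ if $i+1$ appears in a row strictly south of (below) the row of $i$; $\mathrm{Des}(T)$ is the set of descents. Descent vector of a staircase tableau: for $S\in SYT(sc_k)$, $\mathrm{Des}_e(S)$ is an array of $2n$ boxes. For $1\le i\le n-1$: if $i\in\mathrm{Des}(S)$ the $i$-th box is dotted and the $(n+i)$-th is empty; otherwise the $(n+i)$-th box is dotted and the $i$-th is empty. If $1\in\mathrm{Des}(\partial(S))$ the $n$-th box is empty and the $2n$-th is dotted; otherwise the $n$-th box is dotted and the $2n$-th is empty. The array is regarded as circular (indices mod $2n$). Rotating to the right by one position sends the content of box $i$ to box $i+1$ (mod $2n$); flipping sends the content of box $i$ to box $2n+1-i$. *)

(* Defs.v *)
From mathcomp Require Import all_boot.

Set Implicit Arguments.
Unset Strict Implicit.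
Unset Printing Implicit Defensive.

(* Rows and columns are numbered from 1, so (i.-1, j) and (i, j.-1) are the
   boxes directly north and west of (i, j); index 0 never lies in a shape. *)
Definition box := (nat * nat)%type.

(* Only the values on the boxes of the shape under consideration matter. *)
Definition filling := box -> nat.

Definition boxes (la : seq nat) : seq box :=
  [seq (i, j) | i <- iota 1 (size la), j <- iota 1 (nth 0 la i.-1)].

Definition is_syt (la : seq nat) (T : filling) : Prop :=
  [/\ perm_eq [seq T b | b <- boxes la] (iota 1 (sumn la)),
      forall i j, (i, j) \in boxes la -> (i, j.+1) \in boxes la ->
        T (i, j) < T (i, j.+1)
    & forall i j, (i, j) \in boxes la -> (i.+1, j) \in boxes la ->
        T (i, j) < T (i.+1, j)].

Definition locate (s : seq box) (T : filling) (v : nat) : box :=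
  nth (0, 0) s (index v [seq T b | b <- s]).

(* The box whose entry moves into the empty box b, if there is one. *)
Definition slide_source (s : seq box) (T : filling) (b : box) : option box :=
  let north := (b.1.-1, b.2) in
  let west := (b.1, b.2.-1) in
  match north \in s, west \in s with
  | true, true => Some (if T west < T north then north else west)
  | true, false => Some north
  | false, true => Some west
  | false, false => None
  end.

(* Each step decreases b.1 + b.2, so the bound r = b.1 + b.2 in [slide] is never
   what stops the process.  The value left at the empty box is meaningless. *)
Fixpoint slide_rec (r : nat) (s : seq box) (T : filling) (b : box) :
    filling * box :=
  if r is r'.+1 then
    if slide_source s T b is Some c then
      slide_rec r' s [eta T with b |-> T c] c
    else (T, b)
  else (T, b).

Definition slide (s : seq box) (T : filling) (b : box) : filling * box :=
  slide_rec (b.1 + b.2) s T b.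

Definition promotion (la : seq nat) (T : filling) : filling :=
  let: (T', e) := slide (boxes la) T (locate (boxes la) T (sumn la)) in
  fun b => ([eta T' with e |-> 0] b).+1.

(* r removals remain to be done from the filling T of the skew shape s, and the
   next final position of the empty box is labelled v. *)
Fixpoint evacuation_rec (r : nat) (s : seq box) (T : filling) (v : nat) :
    filling :=
  if r is r'.+1 then
    let: (T', e) := slide s T (locate s T (\max_(b <- s) T b)) in
    [eta evacuation_rec r' (rem e s) T' v.+1 with e |-> v]
  else fun=> 0.

Definition evacuation (la : seq nat) (T : filling) : filling :=
  evacuation_rec (sumn la) (boxes la) T 1.

Definition descent (la : seq nat) (T : filling) (i : nat) : bool :=
  has (fun b => has (fun c => [&& T b == i, T c == i.+1 & b.1 < c.1])
                    (boxes la))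
      (boxes la).

Definition staircase (k : nat) : seq nat := rev (iota 1 k).

(* Boxes 1, ..., 2n of the array in this order; true means dotted. *)
Definition Des_e (k : nat) (S : filling) : seq bool :=
  let n := (k * k.+1)./2 in
  let la := staircase k in
  let d := descent la (promotion la S) 1 in
  [seq descent la S i | i <- iota 1 n.-1] ++ [:: ~~ d] ++
  [seq ~~ descent la S i | i <- iota 1 n.-1] ++ [:: d].

(* The i-th box of a circular array whose boxes are numbered from 1, with i
   taken modulo the size of the array (so index 0 is the last box). *)
Definition circ_box (a : seq bool) (i : nat) : bool :=
  nth false a ((i + (size a).-1) %% size a).

Definition rotate_right (a : seq bool) : seq bool := rotr 1 a.

Definition flip (a : seq bool) : seq bool := rev a.

(* Main.v *)
Require Import Defs.
From mathcomp Require Import all_boot.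
From mathcomp Require Import zify.

Set Implicit Arguments.
Unset Strict Implicit.
Unset Printing Implicit Defensive.

(** Encode a standard filling by its word, the list of boxes carrying 1, 2, ...
in this order.  Sliding the empty box past the entries in decreasing order, one
sees that an entry is moved exactly when it sits directly north or west of the
empty box at that moment.  So the slide is a composition of local moves on
words, [toggle]: the letter e travelling to the left past a letter p exchanges
places with it, unless e is directly south or east of p, in which case p takes
over the journey.  Promotion [prom] lets the last letter travel to the front,
and evacuation [evac] repeats this on what remains behind the front letter.

Three facts do the work; the first and the third hold for linear extensions of
arbitrary convex sets of boxes.

- Only three letters are involved when a letter travels past a consecutive pair
  or a pair travels past a letter, and both preserve whether the second member
  of the pair lies south of the first ([des_toggle_right], [des_toggle_left]).
  The former makes promotion shift the descents by one ([des_prom]); the latter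
  compares the letters a, b travelling one after the other to the front of a
  word with the two front letters that result ([des_foldr_left]).

- In a staircase the two largest entries are never adjacent
  ([last_two_staircase]).  Promotion preserves the shape, so this applies to all
  the iterated promotions of S.  The first two letters of the evacuation are
  where the journeys of n and of n - 1 end; the boxes of n and n - 1 being
  incomparable, 1 is a descent of the evacuation if and only if n is not south
  of n - 1.  Moving this along with promotion, i is a descent of the evacuation
  if and only if n - i is not a descent of S ([des_evac]).  This accounts for
  all the boxes of the descent vector but the n-th and the last.

- Promoting the evacuation of x :: w yields x :: evac w, that is, it undoes the
  passage of the travelling letters over x ([prom_evac]).  For a staircase, x is the
  corner (1, 1), and both this word and prom (x :: w) begin with x followed by
  the first letter of prom w ([des1_prom_evac]).  Hence the two remaining boxes
  do not change.

Rotating and flipping exchanges box i with box 2n - i.  As boxes i and n + i have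
opposite contents, this is what the last two items say. *)

(** * Words of boxes *)

Definition nw (x y : box) := (x.1 <= y.1) && (x.2 <= y.2).

Definition adj (p q : box) := (q == (p.1.+1, p.2)) || (q == (p.1, p.2.+1)).

(** The shape is not a parameter: the word is a linear extension of its own set
of letters, which has to be convex for the product order, as skew shapes are.
Convexity is what makes consecutive comparable letters adjacent. *)
Definition linext (w : seq box) : Prop :=
  pairwise (fun x y => ~~ nw y x) w /\
  forall x y z, x \in w -> y \in w -> nw x z -> nw z y -> z \in w.

(** The letter at the head of [w] travels to the left past [p].  If it is
adjacent to [p], the value of [p] moves into the box [e], and [p] is the empty
box from then on. *)
Definition toggle (p : box) (w : seq box) : seq box :=
  if w is e :: w' then if adj p e then p :: w else e :: p :: w' else [:: p].

Definition prom (w : seq box) : seq box := foldr toggle [::] w.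

Fixpoint evac_rec (r : nat) (w : seq box) : seq box :=
  if r is r'.+1 then
    if prom w is e :: w' then e :: evac_rec r' w' else [::]
  else [::].

Definition evac (w : seq box) : seq box := evac_rec (size w) w.

Definition des (w : seq box) (i : nat) : bool :=
  (nth (0, 0) w i.-1).1 < (nth (0, 0) w i).1.

Lemma adj_nw p q : adj p q -> nw p q && ~~ nw q p.
Proof.
by case: p q => [a b] [c d]; rewrite /adj /nw !xpair_eqE /=; lia.
Qed.

(** A box between two letters of a factor cannot occur outside the factor, as
it would be comparable to one of them in the wrong direction; so convexity is
inherited, and local questions concern words of two or three letters. *)
Lemma linext_infix u m v : linext (u ++ m ++ v) -> linext m.
Proof.
case; rewrite !pairwise_cat allrel_catr => /and3P[/andP[um _] _ /and3P[mv m_ _]].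
move=> conv; split=> // x y z xm ym xz zy.
have := conv x y z; rewrite !mem_cat xm ym !orbT => /(_ isT isT xz zy).
case/or3P => // zin.
- by move/allrelP: um => /(_ _ _ zin xm); rewrite xz.
- by move/allrelP: mv => /(_ _ _ ym zin); rewrite zy.
Qed.

Lemma linext_uniq w : linext w -> uniq w.
Proof. by case=> pw _; apply: pairwise_uniq pw => x; rewrite /nw !leqnn. Qed.

(** If q is weakly south-east of p but not adjacent to it, then the next box
from p towards q would have to be a third letter. *)
Lemma linext_pair p q : linext [:: p; q] -> adj p q = nw p q.
Proof.
case: p q => [a b] [c d] [] /=; rewrite !andbT => nqp conv.
apply/idP/idP => [/adj_nw /andP[] // | npq].
move: nqp npq (conv (a, b) (c, d) (a.+1, b)) (conv (a, b) (c, d) (a, b.+1)).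
by rewrite /adj /nw !inE !xpair_eqE /=; lia.
Qed.

(** * Promotion of linear extensions *)

Lemma linext_swap u p e z :
  linext (u ++ p :: e :: z) -> ~~ adj p e -> linext (u ++ e :: p :: z).
Proof.
move=> lw nadj.
have /linext_pair E : linext [:: p; e] by apply: (@linext_infix u _ z).
case: lw => pw conv; have swp : perm_eq (u ++ e :: p :: z) (u ++ p :: e :: z).
  by rewrite perm_cat2l -![_ :: _ :: z]/([:: _; _] ++ z) perm_cat2r
    (perm_catC [:: e]).
split=> [|x y t]; last by rewrite !(perm_mem swp); apply: conv.
move: pw; rewrite !pairwise_cat /= -E nadj /=.
rewrite (allrel_consr _ _ p (e :: z)) (allrel_consr _ _ e z).
rewrite (allrel_consr _ _ e (p :: z)) (allrel_consr _ _ p z).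
by case/and3P => /and3P[-> -> ->] -> /and3P[/andP[_ ->] -> ->].
Qed.

Lemma linext_toggle u p w : linext (u ++ p :: w) -> linext (u ++ toggle p w).
Proof.
by case: w => [|e w] //= lw; case: ifPn => // /(linext_swap lw).
Qed.

Lemma linext_foldr u v w : linext (u ++ v ++ w) -> linext (u ++ foldr toggle w v).
Proof.
elim: v u => [|p v IH] u //=; rewrite -cat_rcons => /IH.
by rewrite cat_rcons; apply: linext_toggle.
Qed.

Lemma linext_prom u w : linext (u ++ w) -> linext (u ++ prom w).
Proof. by rewrite -{1}(cats0 w); apply: linext_foldr. Qed.

Lemma perm_toggle p w : perm_eq (toggle p w) (p :: w).
Proof.
case: w => [|e w] //=; case: ifP => // _.
by rewrite -![_ :: _ :: w]/([:: _; _] ++ w) perm_cat2r (perm_catC [:: e]).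
Qed.

Lemma perm_foldr w v : perm_eq (foldr toggle w v) (v ++ w).
Proof.
elim: v => [|p v IH] //=.
by apply: perm_trans (perm_toggle _ _) _; rewrite perm_cons.
Qed.

Lemma perm_prom w : perm_eq (prom w) w.
Proof. by rewrite -{2}(cats0 w); apply: perm_foldr. Qed.

Lemma size_prom w : size (prom w) = size w.
Proof. exact: perm_size (perm_prom w). Qed.

(** A journey only affects the letters that it passes. *)
Lemma toggle_cat p e z : toggle p (e :: z) = toggle p [:: e] ++ z.
Proof. by rewrite /=; case: ifP. Qed.

Lemma foldr_toggle_cat e z u :
  foldr toggle (e :: z) u = foldr toggle [:: e] u ++ z.
Proof.
elim: u => [|p u IH] //=; rewrite IH.
have := perm_size (perm_foldr [:: e] u).
case: (foldr toggle [:: e] u) => [|x s] /=; first by rewrite size_cat addn1.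
by case: ifP.
Qed.

Lemma prom_cons x w : 
  exists e v, prom (x :: w) = e :: v /\ size v = size w.
Proof.
have := size_prom (x :: w).
by case: (prom _) => [|e v] //= [sv]; exists e, v.
Qed.

Lemma evac_cons w e w' : prom w = e :: w' -> evac w = e :: evac w'.
Proof.
move=> E; have := size_prom w; rewrite E /= => sw.
by rewrite /evac -sw /= E.
Qed.

(** * How travelling letters affect descents *)

(** A letter e travels past the pair p, q.  If p and q are incomparable, one
lies strictly south-west of the other, and replacing one of them by e, the box
into which its value moves, leaves the comparison of rows as it was.  If q is
adjacent to p, either e is the other neighbour of p, and then p and e compare
alike with q, or p, q and e form a chain.  By convexity this chain cannot turn,
since the fourth box of the square would be a further letter, and so the pairs
p, q and q, e have the same direction. *)
Lemma des_toggle_right p q e e' p' q' :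
  linext [:: p; q; e] -> toggle p (toggle q [:: e]) = [:: e'; p'; q'] ->
  (p'.1 < q'.1) = (p.1 < q.1).
Proof.
move=> lw.
have /linext_pair : linext [:: p; q] by apply: (@linext_infix [::] _ [:: e]).
have /linext_pair : linext [:: q; e] by apply: (@linext_infix [:: p] _ [::]).
case: lw; case: p q e => [a b] [c d] [f g].
rewrite [pairwise _ _]/= => pw conv.
move: (conv (a, b) (f, g) (a.+1, b)) (conv (a, b) (f, g) (a, b.+1)) pw.
rewrite /toggle.
have E x y z t : adj (x, y) (z, t) = (z == x.+1) && (t == y) || (z == x) && (t == y.+1).
  by rewrite /adj !xpair_eqE.
rewrite /nw !inE !xpair_eqE !E /=.
by do 2 (case: ifP; rewrite ?E => /= ?); move=> c1 c2 c3 c4 c5 [] *; subst => /=; lia.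
Qed.

(** Toggles are involutions, because the letters of a linear extension are never
adjacent in the reverse order. *)
Lemma toggle_pairK p a : linext [:: p; a] -> 
  forall a' p', toggle p [:: a] = [:: a'; p'] -> toggle a' [:: p'] = [:: p; a].
Proof.
move=> [/= /andP[/andP[nap _] _] _] a' p'; case: ifPn => pa [<- <-] /=; rewrite ?pa //.
by case: ifPn => // /adj_nw /andP[]; rewrite (negPf nap).
Qed.

(** The pair a, b travels past p.  Undoing the two toggles makes p travel
back past the pair, which is the situation of [des_toggle_right]. *)
Lemma des_toggle_left p a b a' p' b' p'' :
  linext [:: p; a; b] ->
  toggle p [:: a] = [:: a'; p'] -> toggle p' [:: b] = [:: b'; p''] ->
  (a'.1 < b'.1) = (a.1 < b.1).
Proof.
move=> lw E1 E2.
have l1 : linext [:: a'; p'; b].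
  by have := @linext_toggle [::] p [:: a; b] lw; rewrite cat0s toggle_cat E1.
have l2 : linext [:: a'; b'; p''].
  by have := @linext_toggle [:: a'] p' [:: b] l1; rewrite E2.
have K1 := toggle_pairK (@linext_infix [::] [:: p; a] [:: b] lw) E1.
have K2 := toggle_pairK (@linext_infix [:: a'] [:: p'; b] [::] l1) E2.
apply/esym; apply: (des_toggle_right (e' := p) l2).
by rewrite K2 toggle_cat K1.
Qed.

Lemma toggle1 p a : exists a' p', toggle p [:: a] = [:: a'; p'].
Proof. by rewrite /=; case: ifP; [exists p, a | exists a, p]. Qed.

Lemma foldr_toggle1 u a :
  exists a' u', foldr toggle [:: a] u = a' :: u' /\ size u' = size u.
Proof.
have := perm_size (perm_foldr [:: a] u).
case: (foldr _ _ u) => [|a' u']; rewrite size_cat addn1 //= => -[<-].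
by exists a', u'.
Qed.

(** Toggles at disjoint places commute, so instead of letting a travel to the
front before b sets out, one may let both pass each letter of u before they turn
to the next one; then [des_toggle_left] applies at every letter. *)
Lemma des_foldr_left u a b a' u' b' u'' :
  linext (u ++ [:: a; b]) ->
  foldr toggle [:: a] u = a' :: u' -> foldr toggle [:: b] u' = b' :: u'' ->
  (a'.1 < b'.1) = (a.1 < b.1).
Proof.
elim/last_ind: u => [|u p IH] in a b a' u' b' u'' *.
  by move=> _ [<- <-] [<-].
rewrite cat_rcons -!cats1 !foldr_cat [foldr _ _ [:: p]]/= -/(toggle p [:: a]).
have [a1 [p1 E1]] := toggle1 p a; have [b1 [p2 E2]] := toggle1 p1 b.
rewrite E1 foldr_toggle_cat.
have [a2 [u1 [E3 _]]] := foldr_toggle1 u a1.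
rewrite E3 => lw [<- <-]; rewrite foldr_cat [foldr _ _ [:: _]]/= -/(toggle p1 [:: b]) E2.
rewrite foldr_toggle_cat; have [b2 [u2 [E4 _]]] := foldr_toggle1 u1 b1.
rewrite E4 => -[<- _].
have l3 : linext [:: p; a; b] by apply: (@linext_infix u _ [::]); rewrite cats0.
rewrite -(des_toggle_left l3 E1 E2); apply: (IH _ _ _ _ _ _ _ E3 E4).
have := @linext_toggle _ _ _ lw; rewrite toggle_cat E1 => lw1.
have := @linext_toggle (rcons u a1) p1 [:: b]; rewrite !cat_rcons E2 => /(_ lw1).
rewrite -[[:: a1, b1 & _]]/([:: a1; b1] ++ [:: p2]) => lw2.
by have := @linext_infix [::] (u ++ [:: a1; b1]) [:: p2]; rewrite -catA; apply.
Qed.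

(** The travelling letter passes the pair at positions j and j + 1, and its
arrival at the front shifts the pair by one. *)
Lemma des_prom w j :
  linext w -> 0 < j -> j.+1 < size w -> des (prom w) j.+1 = des w j.
Proof.
case: j => // j lw _ jw.
rewrite -(cat_take_drop j w) in lw *.
have : size (drop j w) = (size w - j.+3).+3 by rewrite size_drop; lia.
have : size (take j w) = j by rewrite size_takel //; lia.
case: (drop j w) (take j w) lw => [|p [|q v]] u //= lw su [sv].
have -> : prom (u ++ [:: p, q & v]) = foldr toggle (toggle p (toggle q (prom v))) u.
  by rewrite /prom foldr_cat.
have : linext (u ++ [:: p, q & prom v]).
  by have := @linext_prom (u ++ [:: p; q]) v; rewrite -!catA; apply.
have : size (prom v) = (size w - j.+3).+1 by rewrite size_prom.
case: (prom v) => [|e z] // _ {}lw.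
have [q1 [e1 E1]] := toggle1 q e; have [p1 [q2 E2]] := toggle1 p q1.
have l3 : linext [:: p; q; e] by apply: (@linext_infix u _ z).
have E3 : toggle p (toggle q [:: e]) = [:: p1; q2; e1].
  by rewrite E1 toggle_cat E2.
rewrite toggle_cat E1 toggle_cat E2.
have [p2 [u1 [E4 su1]]] := foldr_toggle1 u p1.
have jj : (j.+1 < j) = false by lia.
rewrite foldr_toggle_cat E4 /des /= !nth_cat su1 su ltnn jj subnn subSnn /=.
exact: des_toggle_right l3 E3.
Qed.

(** In terms of growth diagrams, the words along two neighbouring columns are
related by promotion just as those along two neighbouring rows are.  Here this
follows by induction on w: the toggle of x with the head e of prom w, the last
one in the promotion of x :: w, has the same outcome as the last one in the
promotion of the evacuation. *)
Lemma prom_evac x w : linext (x :: w) -> prom (evac (x :: w)) = x :: evac w.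
Proof.
have [m] := ubnP (size w); elim: m => // m IH in x w *.
case: w => [|y w] // sw lw.
have [e [v [E sv]]] := prom_cons y w.
have lw1 : linext [:: x, e & v] by rewrite -E; apply: (@linext_prom [:: x]).
have sv_m : size v < m by rewrite sv.
have Ew : evac (y :: w) = e :: evac v by apply: evac_cons.
have prom_consE p z : prom (p :: z) = toggle p (prom z) by [].
case: (boolP (adj x e)) => xe.
- have Ex : prom (x :: y :: w) = [:: x, e & v] by rewrite prom_consE E /= xe.
  rewrite (evac_cons Ex) Ew prom_consE IH /= ?xe //.
  by apply: (@linext_infix [:: x] _ [::]); rewrite cats0.
- have Ex : prom (x :: y :: w) = [:: e, x & v].
    by rewrite prom_consE E /= (negPf xe).
  have lw2 := @linext_swap [::] _ _ _ lw1 xe.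
  rewrite (evac_cons Ex) Ew prom_consE IH //=.
    case: ifP => // /adj_nw /andP[ex _].
    by case: lw1 => /= /andP[/andP[]]; rewrite ex.
  by apply: (@linext_infix [:: e] _ [::]); rewrite cats0.
Qed.

Lemma evac_rec_perm_linext r w : size w = r -> 
  perm_eq (evac_rec r w) w /\ forall u, linext (u ++ w) -> linext (u ++ evac_rec r w).
Proof.
elim: r w => [|r IH] [|x w] //= [sw].
have [e [v [E sv]]] := prom_cons x w; rewrite -/(prom (x :: w)).
rewrite -[toggle x _]/(prom (x :: w)) E.
have [pe le] := IH v (etrans sv sw).
have pv : perm_eq (e :: v) (x :: w) by rewrite -E perm_prom.
split; first by rewrite (perm_trans _ pv) // perm_cons.
by move=> u lw; rewrite -cat_rcons; apply: le; rewrite cat_rcons -E; apply: linext_prom.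
Qed.

Lemma perm_evac w : perm_eq (evac w) w.
Proof. by case: (evac_rec_perm_linext (erefl (size w))). Qed.

Lemma linext_evac w : linext w -> linext (evac w).
Proof. by case: (evac_rec_perm_linext (erefl (size w))) => _ /(_ [::]). Qed.

Definition last_two_nonadjacent (s : seq box) :=
  forall u q r, perm_eq (u ++ [:: q; r]) s -> linext (u ++ [:: q; r]) -> ~~ adj q r.

(** The word w is what remains behind the letters u that have completed their
journeys, and u ++ w is an iterated promotion; hence the hypothesis on the shape
s applies to the last two letters of w although w itself is skew.  For i = 1
these two letters are first exchanged, as they are not adjacent, and then travel
as a pair to the front; the exchange is where the negation comes from. *)
Lemma des_evac s u w i : last_two_nonadjacent s ->
  perm_eq (u ++ w) s -> linext (u ++ w) -> 0 < i < size w ->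
  des (evac w) i = ~~ des w (size w - i).
Proof.
move=> apart; elim: i u w => [|i IH] u w // ps lw /= iw.
have [x [w0 Ew0]] : exists x w0, w = x :: w0 by case: (w) iw => // x w0; exists x, w0.
have [e [v [E]]] := prom_cons x w0; rewrite -Ew0 in E => sv.
have sw : size w = (size v).+1 by rewrite Ew0 /= sv.
rewrite (evac_cons E); case: i IH iw => [_|i IH] iw.
- have [z [q [r Ez]]] : exists z q r, w = z ++ [:: q; r].
    case/lastP: {+}w iw => [|w1 r] //; rewrite size_rcons.
    case/lastP: w1 => [|z q] // _.
    by exists z, q, r; rewrite -!cats1 -catA.
  have l2 : linext [:: q; r] by apply: (@linext_infix (u ++ z) _ [::]); rewrite cats0 -catA -Ez.
  have nqr : ~~ adj q r by apply: (apart (u ++ z)); rewrite -catA -Ez.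
  have Epr : prom w = foldr toggle [:: r] z ++ [:: q].
    by rewrite Ez /prom foldr_cat /= (negPf nqr) foldr_toggle_cat.
  have [a [z1 [Ea _]]] := foldr_toggle1 z r.
  have [b [z2 [Eb _]]] := foldr_toggle1 z1 q.
  have [Eae Ev] : a = e /\ v = z1 ++ [:: q] by move: Epr; rewrite E Ea => -[].
  have Epv : prom v = b :: z2 by rewrite Ev /prom foldr_cat Eb.
  rewrite (evac_cons Epv) /des [X in X < _]/= [X in _ < X]/= -Eae.
  have lz : linext (z ++ [:: r; q]).
    apply: (@linext_swap z q r [::]) nqr.
    by apply: (@linext_infix u _ [::]); rewrite cats0 -Ez.
  have zz : ((size z).+1 < size z) = false by lia.
  rewrite (des_foldr_left lz Ea Eb) Ez size_cat addn2 subn1 /= !nth_cat ltnn zz.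
  rewrite subnn subSnn /=.
  move: (linext_pair l2) nqr => Eq; rewrite Eq => nqr.
  case: l2 => /=; rewrite !andbT => nrq _.
  by move: nrq nqr; rewrite /nw; case: (q) (r) => [a1 b1] [a2 b2] /=; lia.
- have lv : linext ((u ++ [:: e]) ++ v) by rewrite -catA /= -E; apply: linext_prom.
  have pv : perm_eq ((u ++ [:: e]) ++ v) s.
    by rewrite -catA /= -E (perm_trans _ ps) // perm_cat2l perm_prom.
  have lw0 : linext w by apply: (@linext_infix u _ [::]); rewrite cats0.
  rewrite -[LHS]/(des (evac v) i.+1) (IH _ _ pv lv); last by rewrite sw ltnS in iw.
  rewrite sw ltnS subSS in iw *.
  have [m Em] : exists m, size v - i.+1 = m.+1 by exists (size v - i.+2); lia.
  by rewrite Em -(des_prom lw0) ?E // sw; lia.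
Qed.

(** The minimum x is adjacent to the first letter e of the promotion of w, as
x and e are consecutive and comparable.  So both words begin with x, e. *)
Lemma des1_prom_evac x w : linext (x :: w) -> (forall y, y \in w -> nw x y) ->
  des (prom (evac (x :: w))) 1 = des (prom (x :: w)) 1.
Proof.
move=> lw min; rewrite prom_evac //.
case: w => [|y w] // in lw min *.
have [e [v [E _]]] := prom_cons y w.
have lw1 : linext [:: x, e & v] by rewrite -E; apply: (@linext_prom [:: x]).
have xe : adj x e.
  rewrite (linext_pair (@linext_infix [::] [:: x; e] v lw1)); apply: min.
  by rewrite -(perm_mem (perm_prom _)) E mem_head.
by rewrite (evac_cons E) -[prom (x :: y :: w)]/(toggle x (prom (y :: w))) E /= xe.
Qed.

(** * Slides, promotion and evacuation of fillings through words *)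

Definition reads (s : seq box) (T : filling) (w : seq box) :=
  perm_eq w s /\ map T w = iota 1 (size w).

(** In row or column 0, truncated subtraction would make a box its own northern
or western neighbour. *)
Definition positive (s : seq box) := forall b, b \in s -> 0 < b.1 /\ 0 < b.2.

Lemma slide_source_min s T w b : perm_eq (b :: w) s -> linext (b :: w) ->
  0 < b.1 -> 0 < b.2 -> slide_source s T b = None.
Proof.
move=> ps [/= /andP[/allP bw _] _] b1 b2.
have no c : nw c b -> c != b -> (c \in s) = false.
  move=> cb ncb; rewrite -(perm_mem ps) inE (negPf ncb) /=.
  by apply/negP => /bw; rewrite cb.
by rewrite /slide_source !no //; case: b b1 b2 {ps bw no} => [a c] /=;
  rewrite /nw ?xpair_eqE /=; lia.
Qed.

(** The state of the slide after the values larger than those of u have been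
examined: b is empty and z lists the boxes holding these values.  If the last
letter p of u is adjacent to b, then it is the neighbour with the larger entry,
since all boxes other than p that lie north or west of b precede p; otherwise
the slide pays no attention to p, and p joins z. *)
Lemma slide_recE s u : positive s ->
  forall r T b z, perm_eq (u ++ b :: z) s -> linext (u ++ b :: z) ->
  map T u = iota 1 (size u) -> map T z = iota (size u).+1 (size z) ->
  b.1 + b.2 <= r ->
  let: (T', e) := slide_rec r s T b in
  exists2 w, foldr toggle (b :: z) u = e :: w & map T' w = iota 1 (size w).
Proof.
move=> pos; elim/last_ind: u => [|u p IH] r T b z ps lw Tu Tz br.
  have [b1 b2] : 0 < b.1 /\ 0 < b.2 by apply: pos; rewrite -(perm_mem ps) mem_head.
  have := slide_source_min T ps lw b1 b2.
  by case: r br => [|r] br /= => [|->]; exists z.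
have [b1 b2] : 0 < b.1 /\ 0 < b.2.
  by apply: pos; rewrite -(perm_mem ps) mem_cat mem_head orbT.
move: Tu; rewrite map_rcons size_rcons -(addn1 (size u)) iotaD cats1 add1n => /rcons_inj [Tu Tp].
rewrite cat_rcons in ps lw; rewrite size_rcons in Tz.
rewrite -cats1 foldr_cat [foldr _ _ [:: p]]/=; case: ifPn => pb; last first.
  apply: IH => //=.
  - rewrite (perm_trans _ ps) // perm_cat2l -![_ :: _ :: z]/([:: _; _] ++ z) perm_cat2r.
    by rewrite (perm_catC [:: b]).
  - exact: linext_swap.
  - by rewrite Tp Tz.
(* A letter weakly north-west of b cannot come after b, so it lies in u. *)
have smaller c : nw c b -> c != b -> c != p -> c \in s -> T c < T p.
  move=> cb ncb ncp; rewrite -(perm_mem ps) mem_cat !inE (negPf ncb) (negPf ncp) /=.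
  case/orP => [cu|cz].
    by have := map_f T cu; rewrite Tu mem_iota Tp; lia.
  have := @linext_infix (u ++ [:: p]) (b :: z) [::].
  rewrite cats0 -catA => /(_ lw) [/= /andP[/allP/(_ _ cz)]].
  by rewrite cb.
have ps_p : p \in s by rewrite -(perm_mem ps) mem_cat mem_head orbT.
have pE : p = (b.1.-1, b.2) \/ p = (b.1, b.2.-1).
  by move: pb; rewrite /adj; case: (b) (p) => [? ?] [? ?] /orP[] /eqP[-> ->]; [left | right].
have src : slide_source s T b = Some p.
  case: pE => pE; rewrite /slide_source -pE ps_p.
  - case E: (_ \in s) => //; rewrite smaller //.
    + by rewrite /nw /= ?leqnn ?leq_pred.
    + by case: (b) b1 b2 => b3 b4 /= b1 b2; rewrite xpair_eqE; lia.
    + by rewrite pE; case: (b) b1 b2 => b3 b4 /= b1 b2; rewrite xpair_eqE; lia.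
  - case E: (_ \in s) => //; rewrite ltnNge ltnW ?smaller //.
    + by rewrite /nw /= ?leqnn ?leq_pred.
    + by case: (b) b1 b2 => b3 b4 /= b1 b2; rewrite xpair_eqE; lia.
    + by rewrite pE; case: (b) b1 b2 => b3 b4 /= b1 b2; rewrite xpair_eqE; lia.
case: r br => [|r] br; first by lia.
rewrite /= src.
have [bu bz] : b \notin rcons u p /\ b \notin z.
  have := linext_uniq lw; rewrite -cat_rcons cat_uniq /= => /and3P[_ + /andP[-> _]].
  by rewrite negb_or => /andP[->].
have Teta t : b \notin t -> map [eta T with b |-> T p] t = map T t.
  by move=> bt; apply/eq_in_map => x xt /=; case: eqP bt => // <-; rewrite xt.
apply: IH => //.
- by rewrite Teta // ; move: bu; rewrite mem_rcons inE negb_or => /andP[].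
- by rewrite /= eqxx Teta // Tz Tp.
- by move: br pb; rewrite /adj; case: (b) (p) => [? ?] [? ?]; rewrite !xpair_eqE /=; lia.
Qed.

Lemma locateE s T w b : reads s T w -> b \in w -> locate s T (T b) = b.
Proof.
case=> ps Tw bw; rewrite (perm_mem ps) in bw; rewrite /locate.
have uT : uniq (map T s) by rewrite -(perm_uniq (perm_map T ps)) Tw iota_uniq.
have ib : index b s < size (map T s) by rewrite size_map index_mem.
have := index_uniq 0 ib uT; rewrite (nth_map (0, 0)) ?index_mem // nth_index // => ->.
exact: nth_index.
Qed.

Lemma slideE s T w m : positive s ->
  reads s T w -> linext w -> size w = m.+1 ->
  let: (T', e) := slide s T (locate s T m.+1) in
  exists2 w', prom w = e :: w' & map T' w' = iota 1 m.
Proof.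
case/lastP: w => [|u b] // pos Rw lw; rewrite size_rcons => -[su].
have [ps] := Rw; rewrite map_rcons size_rcons -(addn1 (size u)) iotaD cats1 add1n.
case/rcons_inj => Tu Tb; rewrite su in Tb; rewrite -Tb (locateE Rw) ?mem_rcons ?mem_head //.
rewrite -cats1 in ps lw.
have := slide_recE pos ps lw Tu (erefl _) (leqnn _); rewrite /slide.
case: slide_rec => T' e [w' E Tw']; exists w'; first by rewrite -cats1 /prom foldr_cat.
rewrite Tw'; have := perm_size (perm_foldr [:: b] u).
by rewrite E size_cat addn1 su => -[->].
Qed.

Lemma reads_promotion la T w : positive (boxes la) -> size w = sumn la ->
  reads (boxes la) T w -> linext w ->
  reads (boxes la) (promotion la T) (prom w).
Proof.
move=> pos sw Rw lw; have [ps Tw] := Rw.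
split; first by rewrite (perm_trans (perm_prom w)).
rewrite size_prom /promotion; case: w => [|x w] // in sw Rw lw ps Tw *.
have := slideE pos Rw lw (erefl _); rewrite [X in locate _ _ X]sw.
case: slide => T' e [w' E Tw']; rewrite E /= eqxx; congr (_ :: _).
have ew' : e \notin w'.
  have := linext_uniq lw; rewrite -(perm_uniq (perm_prom _)) E /=.
  by case/andP.
rewrite -[2]/(1 + 1) iotaDl -Tw' -map_comp; apply/eq_in_map => y yw /=.
by case: eqP ew' => // <-; rewrite yw.
Qed.

Lemma bigmax_reads s T w m : reads s T w -> size w = m.+1 ->
  \max_(b <- s) T b = m.+1.
Proof.
case=> ps Tw sw; rewrite -(perm_big _ ps) /= -(big_map T xpredT id) Tw sw.
apply/eqP; rewrite eqn_leq; apply/andP; split.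
  by apply/bigmax_leqP_seq => i; rewrite mem_iota; lia.
by apply: (@leq_bigmax_seq _ (iota 1 m.+1) xpredT id m.+1) => //; rewrite mem_iota; lia.
Qed.

Lemma reads_evacuation_rec r s T w v : positive s -> size w = r ->
  reads s T w -> linext w ->
  map (evacuation_rec r s T v) (evac w) = iota v r.
Proof.
elim: r s T w v => [|r IH] s T w v pos sw Rw lw; first by case: w sw {Rw lw}.
rewrite [evacuation_rec _ _ _ _]/= (bigmax_reads Rw sw).
have := slideE pos Rw lw sw; case: slide => T' e [w' E Tw'].
have [ps _] := Rw; have us : uniq s by rewrite -(perm_uniq ps) linext_uniq.
have pes : perm_eq (e :: w') s by rewrite -E (perm_trans (perm_prom w)).
have pw' : perm_eq w' (rem e s).
  have es : e \in s by rewrite -(perm_mem pes) mem_head.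
  by rewrite -(perm_cons e) (perm_trans pes) // perm_to_rem.
have lw' : linext w'.
  apply: (@linext_infix [:: e] _ [::]); rewrite cats0 -[_ ++ _]/(e :: w') -E.
  exact: (@linext_prom [::]).
have sw' : size w' = r by have := size_prom w; rewrite E sw => -[].
rewrite (evac_cons E) /= eqxx; congr (_ :: _).
rewrite -(IH (rem e s) T' w') //; last 2 first.
- by move=> b /mem_rem; apply: pos.
- by split=> //; rewrite Tw' sw'.
apply/eq_in_map => y yw /=; case: eqP => // ye; move: yw.
have := perm_uniq pes; rewrite us ye (perm_mem (perm_evac w')) /=.
by case/andP => /negPf ->.
Qed.

Lemma reads_evacuation la T w : positive (boxes la) -> size w = sumn la ->
  reads (boxes la) T w -> linext w ->
  reads (boxes la) (evacuation la T) (evac w).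
Proof.
move=> pos sw Rw lw; split.
  by case: Rw => ps _; rewrite (perm_trans (perm_evac w)).
by rewrite (perm_size (perm_evac w)) sw; apply: reads_evacuation_rec.
Qed.

Lemma descentE la T w i : reads (boxes la) T w -> 0 < i < size w ->
  descent la T i = des w i.
Proof.
case=> ps Tw /andP[i0 iw].
have nthT j : j < size w -> T (nth (0, 0) w j) = j.+1.
  by move=> jw; rewrite -(nth_map _ 0) // Tw nth_iota.
have inw j : j < size w -> nth (0, 0) w j \in boxes la.
  by move=> jw; rewrite -(perm_mem ps) mem_nth.
have loc b j : b \in boxes la -> T b = j.+1 -> b = nth (0, 0) w j.
  rewrite -(perm_mem ps) => bw Tb; rewrite -{1}(nth_index (0, 0) bw); congr nth.
  by have := nthT (index b w); rewrite index_mem nth_index // Tb => /(_ bw) [].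
have iw' : i.-1 < size w by rewrite prednK // ltnW.
apply/hasP/idP => [[b bs /hasP[c cs /and3P[/eqP Tb /eqP Tc]]] | di].
  by rewrite (loc b i.-1) ?prednK // (loc c i).
exists (nth (0, 0) w i.-1); first exact: inw.
apply/hasP; exists (nth (0, 0) w i); first exact: inw.
by rewrite !nthT // prednK // !eqxx.
Qed.

(** * Staircase shapes *)

Lemma mem_staircase k (b : box) :
  (b \in boxes (staircase k)) = [&& 0 < b.1, 0 < b.2 & b.1 + b.2 <= k.+1].
Proof.
case: b => i j /=; rewrite /boxes size_rev size_iota.
have nthk a : 0 < a <= k -> nth 0 (staircase k) a.-1 = k.+1 - a.
  by move=> ak; rewrite nth_rev ?size_iota ?nth_iota; lia.
apply/allpairsPdep/idP => [[a [c [ak + [-> ->]]]] | ijk].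
  by move: ak; rewrite !mem_iota => ak; rewrite nthk; lia.
exists i, j; split=> //; first by rewrite mem_iota; lia.
by rewrite mem_iota nthk; lia.
Qed.

Lemma positive_staircase k : positive (boxes (staircase k)).
Proof. by move=> b; rewrite mem_staircase => /and3P[]. Qed.

Lemma sumn_staircase k : sumn (staircase k) = (k * k.+1)./2.
Proof.
rewrite sumn_rev; elim: k => // k IH.
have -> : iota 1 k.+1 = iota 1 k ++ [:: k.+1] by rewrite -(addn1 k) iotaD add1n addn1.
by rewrite sumn_cat IH /=; lia.
Qed.

(** If r were adjacent to q, then q would not be an outer corner, and so both
boxes next to it, to the south and to the east, would belong to the staircase.
The one other than r has no place left in the word behind q. *)
Lemma last_two_staircase k : last_two_nonadjacent (boxes (staircase k)).
Proof.
move=> u q r ps lw; apply/negP => qr.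
have [x [xs nqx xq xr]] : exists x, [/\ x \in boxes (staircase k), nw q x, x != q & x != r].
  have : q \in boxes (staircase k) by rewrite -(perm_mem ps) mem_cat mem_head orbT.
  have : r \in boxes (staircase k).
    by rewrite -(perm_mem ps) mem_cat !inE eqxx !orbT.
  rewrite !mem_staircase; case: q r qr {ps lw} => [i j] [i' j'].
  rewrite /adj => /orP[] /eqP[-> ->] /= H1 H2; [exists (i, j.+1) | exists (i.+1, j)];
  by rewrite mem_staircase /nw !xpair_eqE /=; split; lia.
have [pw _] := lw; move: xs; rewrite -(perm_mem ps) mem_cat !inE (negPf xq) (negPf xr) !orbF.
move=> xu; move: pw; rewrite pairwise_cat => /andP[/allrelP/(_ x q xu (mem_head _ _))].
by rewrite nqx.
Qed.

Lemma syt_le k T x y : is_syt (staircase k) T ->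
  x \in boxes (staircase k) -> y \in boxes (staircase k) -> nw x y -> T x <= T y.
Proof.
case: x y => [a b] [c d] [pT row col] xs + /andP[/= ac bd]; move: xs.
rewrite -(subnKC ac) -(subnKC bd); move: (c - a) (d - b) => p q {ac bd}.
rewrite !mem_staircase /= => xs ys.
apply: (@leq_trans (T (a, b + q))).
  elim: q ys => [|q IH] ys; first by rewrite addn0.
  apply: leq_trans (IH _) _; first by lia.
  by rewrite addnS ltnW // row // mem_staircase /=; lia.
elim: p ys => [|p IH] ys; first by rewrite addn0.
apply: leq_trans (IH _) _; first by lia.
by rewrite addnS ltnW // col // mem_staircase /=; lia.
Qed.

Lemma syt_reading k T : is_syt (staircase k) T ->
  exists w, [/\ reads (boxes (staircase k)) T w, linext w
    & size w = (k * k.+1)./2].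
Proof.
move=> syt; have [pT _ _] := syt; set s := boxes (staircase k) in pT *.
pose w := sort (relpre T leq) s.
have ps : perm_eq w s by rewrite perm_sort.
have sw : size w = (k * k.+1)./2.
  by rewrite (perm_size ps) -sumn_staircase -(size_map T) (perm_size pT) size_iota.
have Tw : map T w = iota 1 (size w).
  rewrite sw -sumn_staircase -sort_map; apply: (sorted_eq leq_trans anti_leq).
  - exact: sort_sorted leq_total _.
  - exact: iota_sorted.
  - by rewrite perm_sort.
exists w; split=> //; split.
- have : pairwise ltn (map T w).
    by rewrite Tw -(sorted_pairwise ltn_trans) iota_ltn_sorted.
  rewrite pairwise_map; apply: (@sub_in_pairwise _ (mem s)).
    move=> x y xs ys /= xy; apply/negP => /(syt_le syt ys xs).
    by rewrite leqNgt xy.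
  by apply/allP => x; rewrite (perm_mem ps).
- move=> x y z; rewrite !(perm_mem ps) !mem_staircase /nw; lia.
Qed.

(** * The descent vector *)

Lemma circ_box_flip_rotate a i : 0 < i <= size a ->
  circ_box (flip (rotate_right a)) i = circ_box a (size a - i).
Proof.
rewrite /circ_box /flip /rotate_right size_rev size_rotr.
case/lastP: a => [|a x]; first by case: i.
rewrite rotr1_rcons rev_cons !size_rcons /= => /andP[].
case: i => // i _ ia; rewrite ltnS in ia.
rewrite addSnnS modnDr modn_small // subSS !nth_rcons size_rev.
case: (ltngtP i (size a)) ia => // [ia | ->] _; last first.
  by rewrite subnn modn_small // ltnn eqxx.
have -> : size a - i + size a = (size a - i).-1 + (size a).+1 by lia.
rewrite modnDr modn_small; last by lia.
by rewrite nth_rev // ifT; [congr nth; lia | lia].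
Qed.

Lemma Des_e_evacuation k S : 2 < k -> is_syt (staircase k) S ->
  Des_e k (evacuation (staircase k) S) = flip (rotate_right (Des_e k S)).
Proof.
move=> k2 syt; have [w [Rw lw sw]] := syt_reading syt.
have pos := @positive_staircase k; set la := staircase k in syt Rw pos *.
have sla : size w = sumn la by rewrite sw sumn_staircase.
have sew : size (evac w) = size w := perm_size (perm_evac w).
have n2 : 1 < size w.
  have /half_leq : 3 * 4 <= k * k.+1 by exact: leq_mul.
  by rewrite -sw; apply: ltn_trans.
have RE := reads_evacuation pos sla Rw lw.
have RP := reads_promotion pos sla Rw lw.
have RPE : reads (boxes la) (promotion la (evacuation la S)) (prom (evac w)).
  by apply: reads_promotion => //; [rewrite sew | apply: linext_evac].
have dE : descent la (promotion la (evacuation la S)) 1 = descent la (promotion la S) 1.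
  rewrite (descentE RPE) ?size_prom ?sew // (descentE RP) ?size_prom //.
  have [ps _] := Rw; have o1 : (1, 1) \in w.
    by rewrite (perm_mem ps) mem_staircase /=; lia.
  have om y : y \in w -> nw (1, 1) y.
    by rewrite (perm_mem ps) mem_staircase /nw /=; lia.
  case: w lw o1 om n2 {sla sew RE RP RPE Rw ps sw} => [|x w] // lw o1 om _.
  have x1 : x = (1, 1).
    move: o1; rewrite inE => /orP[/eqP // | o1].
    by case: lw => /= /andP[/allP/(_ _ o1)]; rewrite om // mem_head.
  by apply: des1_prom_evac => // y yw; rewrite x1 om // inE yw orbT.
have dA : [seq descent la (evacuation la S) i | i <- iota 1 (size w).-1] =
    rev [seq ~~ descent la S i | i <- iota 1 (size w).-1].
  apply: (@eq_from_nth _ false); rewrite ?size_rev !size_map // size_iota => i iw.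
  rewrite nth_rev size_map size_iota // !(nth_map 0) ?size_iota ?nth_iota //; try lia.
  have [ps _] := Rw.
  have iw' : 0 < 1 + i < size w by lia.
  have ii : 1 + ((size w).-1 - i.+1) = size w - (1 + i) by lia.
  rewrite ii (descentE RE) ?sew // (descentE Rw); last by lia.
  by rewrite (@des_evac (boxes la) [::] _ _ (@last_two_staircase k)).
have dA' : [seq ~~ descent la (evacuation la S) i | i <- iota 1 (size w).-1] =
    rev [seq descent la S i | i <- iota 1 (size w).-1].
  rewrite (map_comp negb) dA map_rev -map_comp; congr rev.
  by apply: eq_map => i /=; rewrite negbK.
rewrite /Des_e -/la -sw dE dA dA' /flip /rotate_right !catA.
rewrite [in RHS](cats1 _ (descent _ _ 1)) rotr1_rcons.
by rewrite rev_cons !rev_cat -cats1 -!catA.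
Qed.

Theorem theorem4p13 (k n : nat) (S : filling) :
  2 < k ->
  n = (k * k.+1)./2 ->
  is_syt (staircase k) S ->
  Des_e k (evacuation (staircase k) S) = flip (rotate_right (Des_e k S)) /\
  (forall i : nat, 1 <= i <= 2 * n ->
     circ_box (Des_e k (evacuation (staircase k) S)) i
     <-> circ_box (Des_e k S) (2 * n - i)).
Proof.
move=> k2 nE syt; have DE := Des_e_evacuation k2 syt; split=> // i i2n.
have sD : size (Des_e k S) = 2 * n.
  rewrite /Des_e -nE !size_cat !size_map !size_iota /=.
  by case: n nE {i2n} => [|n] nE; lia.
by rewrite DE circ_box_flip_rotate sD.
Qed.
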